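(* For every $k\ge2$, First-Fit is an optimal deterministic online algorithm for Edge-$k$-Coloring(Tree), with $C_{\mathrm{FF}}^{\text{Tree}}(k)=\frac{k-1}{k}$; that is, FF has competitive ratio exactly $\frac{k-1}{k}$ and no deterministic online algorithm for Edge-$k$-Coloring(Tree) has a larger competitive ratio.
   Context: Online dual edge coloring, Edge-$k$-Coloring: a number $k$ of colors $1,\dots,k$ is given. The edges of a simple graph arrive one by one, each specified by its two endpoints. Upon arrival, an edge must irrevocably either be colored with one of the $k$ colors, such that no two adjacent (sharing an endpoint) colored edges receive the same color, or be rejected. The goal is to color as many edges as possible. Edge-$k$-Coloring(Tree) denotes the restriction to inputs whose graph is a tree. Competitive ratio: for an input sequence $\sigma$, let $\mathrm{ALG}(\sigma)$ be the number of edges colored by ALG and $\mathrm{OPT}(\sigma)$ the maximum number of edges of the input graph that can be properly colored with $k$ colors. ALG is $C$-competitive if there is a constant $b$ with $\mathrm{ALG}(\sigma)\ge C\cdot\mathrm{OPT}(\sigma)-b$ for all inputs $\sigma$; the competitive ratio $C_{\mathrm{ALG}}^{\text{Tree}}(k)$ is the supremum of all such $C$. First-Fit (FF) colors each arriving edge with the lowest color not used on any adjacent edge, and rejects it if no such color exists. *)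

(* Defs.v *)
From HB Require Import structures.
From mathcomp Require Import all_boot all_order all_algebra finmap.
From mathcomp Require Import all_classical all_reals ereal.

Set Implicit Arguments.
Unset Strict Implicit.
Unset Printing Implicit Defensive.

Import Order.TTheory GRing.Theory Num.Theory.

(** Vertices are natural numbers, so that an adversary never runs out of fresh
    ones; the graph of an input has only the endpoints of its edges as
    vertices. *)
Definition edge : Type := {fset nat}.

Definition is_simple (s : seq edge) : bool :=
  uniq s && all (fun e : edge => #|` e| == 2) s.

Definition is_vertex (s : seq edge) (u : nat) : bool :=
  has (fun e : edge => u \in e) s.

(** Irreflexive when [is_simple s], as [[fset u; u]] has cardinal 1. *)
Definition linked (s : seq edge) : rel nat :=
  fun u v => ([fset u; v]%fset : edge) \in s.

Definition is_connected (s : seq edge) : Prop :=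
  forall u v, is_vertex s u -> is_vertex s v ->
  exists2 p : seq nat, path (linked s) u p & last u p = v.

Definition is_acyclic (s : seq edge) : Prop :=
  forall c : seq nat, 2 < size c -> ~ ucycle (linked s) c.

(** Only the complete input is required to be a tree: the edges come in any
    order, and the graph of a proper prefix may be disconnected. *)
Definition is_tree (s : seq edge) : Prop :=
  [/\ is_simple s, is_connected s & is_acyclic s].

Section EdgeColoring.

Variable k : nat.

(** The edges received so far, oldest first, each with its color, or [None] if
    it was rejected.  The colors 1, ..., k are the elements 0, ..., k - 1 of
    ['I_k]. *)
Definition history : Type := seq (edge * option 'I_k).

Definition compatible (x y : edge * option 'I_k) : bool :=
  [|| [disjoint x.1 & y.1]%fset, x.2 == None | x.2 != y.2].

Definition proper_coloring (h : history) : bool := pairwise compatible h.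

Definition num_colored (h : history) : nat := count (fun x => isSome x.2) h.

Definition algorithm : Type := history -> edge -> option 'I_k.

Definition run (A : algorithm) (s : seq edge) : history :=
  foldl (fun h e => rcons h (e, A h e)) [::] s.

Definition tree_algorithm (A : algorithm) : Prop :=
  forall s, is_tree s -> proper_coloring (run A s).

Definition ALG (A : algorithm) (s : seq edge) : nat := num_colored (run A s).

Definition OPT (s : seq edge) : nat :=
  \max_(c : (size s).-tuple (option 'I_k) | proper_coloring (zip s c))
     num_colored (zip s c).

(** [enum 'I_k] lists the colors in increasing order. *)
Definition first_fit : algorithm := fun h e =>
  ohead [seq c <- enum 'I_k | all (compatible (e, Some c)) h].

Definition tree_competitive (R : realType) (A : algorithm) (C : R) : Prop :=
  exists b : R, forall s, is_tree s ->
    ((ALG A s)%:R >= C * (OPT s)%:R - b)%R.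

(** The supremum is taken in the extended reals, where it always exists. *)
Definition tree_competitive_ratio (R : realType) (A : algorithm) : \bar R :=
  ereal_sup [set C%:E | C in [set C : R | tree_competitive A C]]%classic.

End EdgeColoring.

Arguments first_fit : clear implicits.

(* Main.v *)
(** Lower bound for First-Fit. Fix an optimal coloring and orient the edges so
    that every vertex has at most one outgoing edge (to its parent). Let [F] be
    the set of edges colored by First-Fit, [R] the edges colored only by the
    optimum and [X] those colored only by First-Fit; the claim is
    [(k - 1) |R| <= |F| + (k - 1) |X|]. Write [S w] for the set of colors at [w].
    Every edge of [F] carries one coin and every edge of [X] another [k - 1].
    - An edge of [R] from [u] up to [w] takes the coins of the [|S u|] colored
      edges below [u].
    - If [x] has a parent [w] and the edge between them has color [c], then every
      color [c' < c] missing at [w] occurs on an edge below [x], since First-Fit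
      preferred [c] to [c']. This gives [w] a coin for each pair [c' < c].
    - The coins of an edge of [X] are arranged so that each of its two endpoints
      [w] receives [|S w| - 1] coins on top of this.
    What [R]-edges from the children of [w] still lack is at most
    [max(E - 1, 0)] each, where [E] is the number of colors exceeding all colors
    missing at [w]; there are at most [k - |S w| + f] such edges, where [f] is
    the number of [X]-edges at [w], and the coins received by [w] suffice.

    Upper bound for an arbitrary algorithm. The adversary builds a caterpillar
    whose spine follows edges that the algorithm colored: at most [k - 1] of the
    [k + 1] new edges at each spine vertex can then be colored, while [k] of them
    are colored by the optimum. *)

Require Import Defs.
From mathcomp Require Import all_boot all_order all_algebra finmap.
From mathcomp Require Import all_classical all_reals ereal.
From mathcomp Require Import zify lra.

Set Implicit Arguments.
Unset Strict Implicit.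
Unset Printing Implicit Defensive.

(** * Charging argument *)

Section Charging.

Variables (k : nat) (V : finType) (par : V -> V).

(* A vertex [x] with [par x != x] stands for the edge between [x] and [par x];
   roots satisfy [par x = x]. So [star w] lists the edges at [w]. *)
Definition star (w : V) : pred V := [pred x | (x == w) || (par x == w)].

Fact palette_key : unit. Proof. by []. Qed.
(* Locked so that [inE] does not unfold membership. *)
Definition palette (col : V -> option 'I_k) (w : V) : {set 'I_k} :=
  locked_with palette_key [set c | [exists x in star w, col x == Some c]].

Lemma mem_paletteE (col : V -> option 'I_k) (w : V) (c : 'I_k) :
  (c \in palette col w) = [exists x in star w, col x == Some c].
Proof. by rewrite [palette _ _]unlock inE. Qed.

Lemma mem_palette (col : V -> option 'I_k) (w x : V) (c : 'I_k) :
  x \in star w -> col x = Some c -> c \in palette col w.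
Proof.
by move=> xw xc; rewrite mem_paletteE; apply/existsP; exists x; rewrite xw xc eqxx.
Qed.

Lemma mem_paletteP (col : V -> option 'I_k) (w : V) (c : 'I_k) :
  c \in palette col w -> exists2 x, x \in star w & col x = Some c.
Proof. by rewrite mem_paletteE => /existsP[x /andP[xw /eqP xc]]; exists x. Qed.

Definition rooted_coloring (col : V -> option 'I_k) : Prop :=
  (forall x, col x -> par x != x) /\
  (forall w x y c, x \in star w -> y \in star w ->
     col x = Some c -> col y = Some c -> x = y).

(** Properness makes [col] a bijection from the colored edges at [w] onto the colors present
    there. *)
Lemma palette_sum (col : V -> option 'I_k) (w : V) (g : option 'I_k -> nat) :
  rooted_coloring col ->
  \sum_(x in star w | col x) g (col x) = \sum_(c in palette col w) g (Some c).
Proof.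
case=> _ inj.
pose h (c : 'I_k) := odflt w [pick x in star w | col x == Some c].
have hP c : c \in palette col w -> h c \in star w /\ col (h c) = Some c.
  case/mem_paletteP => x xw xc; rewrite /h.
  by case: pickP => [y /andP[yw /eqP yc] //|/(_ x)]; rewrite xw xc eqxx.
have h_inj : {in palette col w &, injective h}.
  move=> c d cS dS E; have [_ hc] := hP c cS; have [_ hd] := hP d dS.
  by apply: Some_inj; rewrite -hc -hd E.
transitivity (\sum_(x in h @: palette col w) g (col x)); last first.
  by rewrite (big_imset _ h_inj); apply: eq_bigr => c /hP[_ ->].
apply: eq_bigl => x; apply/idP/imsetP.
  case/andP=> xw; case E: (col x) => [c|//] _.
  have cp := mem_palette xw E.
  exists c => //; have [hw hc] := hP _ cp; exact: (inj w x (h c) c).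
by case=> c /hP[hw hc] ->; rewrite hw hc.
Qed.

(** A vertex satisfying [P] is no root, so the edge of [w] to its parent is not counted again among
    the edges to the children. *)
Lemma star_split (col : V -> option 'I_k) (w : V) (g : V -> nat) (P : pred V) :
  rooted_coloring col -> (forall x, P x -> col x) ->
  \sum_(x in star w | P x) g x =
  (if P w then g w else 0) + \sum_(x | P x && (par x == w)) g x.
Proof.
move=> [nf _] Pc.
rewrite (bigID (pred1 w)) /=; congr (_ + _).
  case: ifP => Pw.
    rewrite (big_pred1 w) // => x /=.
    by rewrite inE /=; case: eqVneq => [->|]; rewrite ?Pw ?andbF.
  rewrite big_pred0 // => x.
  by rewrite inE /=; case: eqVneq => [->|]; rewrite ?Pw ?andbF.
apply: eq_bigl => x; rewrite inE /=.
case: (eqVneq x w) => [->|xw] /=; last by rewrite andbT andbC.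
rewrite andbF; apply/esym/negbTE/andP => -[Pw].
by rewrite (negbTE (nf w (Pc w Pw))).
Qed.

Variables opt col : V -> option 'I_k.
Hypothesis (opt_ok : rooted_coloring opt) (col_ok : rooted_coloring col).

Let S := palette col.
Let F x : bool := col x.
Let X x : bool := col x && ~~ opt x.
Let R x : bool := opt x && ~~ col x.

(** Together with [FF_rejected], all that the charging takes from First-Fit: a color passed over
    occurs at an endpoint of the edge in the final coloring. *)
Hypothesis FF_colored : forall x (c c' : 'I_k), col x = Some c -> c' < c ->
  c' \in S x :|: S (par x).
Hypothesis FF_rejected : forall x c, R x -> c \in S x :|: S (par x).

(* [below w (Some c)] is the number of colors below [c] missing at [w]; [top w]
   is the set of colors above all the colors missing at [w]. *)
Let below (w : V) (c : option 'I_k) : nat :=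
  #|[set c' | (c' \notin S w) && (if c is Some d then c' < d else false)]|.
Let above (w : V) : {set 'I_k} := [set c : 'I_k | [forall c' in S w, c' < c]].
Let top (w : V) : {set 'I_k} := [set c : 'I_k | [forall c' in ~: S w, c' < c]].

Let deg w := #|S w|.
Let codeg w := #|~: S w|.
Let n_above w := #|above w|.
Let n_top w := #|top w|.

Lemma card_palette w :
  deg w = F w + \sum_(x | F x && (par x == w)) 1.
Proof.
by rewrite /deg -sum1_card -(palette_sum w (fun=> 1)) // (star_split _ _ col_ok).
Qed.

Lemma deg_codeg w : deg w + codeg w = k.
Proof. by rewrite /deg /codeg cardsC card_ord. Qed.

Lemma top_sub w : top w \subset S w.
Proof.
apply/fintype.subsetP => c; rewrite inE => /forallP/(_ c).
by rewrite !inE ltnn implybF negbK.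
Qed.

Lemma below_top w c : c \in top w -> below w (Some c) = codeg w.
Proof.
rewrite inE => /forallP ct; apply: eq_card => c'; rewrite !inE.
by case: (boolP (c' \in S w)) => //= cS; apply: (implyP (ct c')); rewrite inE cS.
Qed.

(** Each color of [top w] has all [codeg w] missing colors below it, and leaving out [m] costs at
    most one color of [top w]. *)
Lemma below_sum w m :
  codeg w * (n_top w).-1 <= \sum_(c in S w | c != m) below w (Some c).
Proof.
apply: (@leq_trans (\sum_(c in top w | c != m) below w (Some c))).
  rewrite (eq_bigr (fun=> codeg w)); last by move=> c /andP[/below_top].
  rewrite sum_nat_const mulnC leq_mul2r; apply/orP; right.
  have -> : #|[pred i in top w | i != m]| = #|top w :\ m|.
    by apply: eq_card => c; rewrite !inE andbC.
  by rewrite /n_top (cardsD1 m (top w)); case: (m \in top w) => /=; lia.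
rewrite [leqRHS](bigID (mem (top w))) /=.
rewrite [X in _ <= X + _](eq_bigl (fun c => (c \in top w) && (c != m))) ?leq_addr //.
move=> c; case ct: (c \in top w); last by rewrite andbF.
by rewrite (fintype.subsetP (top_sub w) _ ct) andbT.
Qed.

(** For the largest color [m] at [w], a missing color is either above everything at [w] or below
    [m]. This pays for the edge of [w] if it is rejected. *)
Lemma below_self w : n_above w + deg w < k ->
  exists2 m, m \in S w & k - deg w - n_above w <= below w (Some m).
Proof.
move=> lt; case: (finset.set_0Vmem (S w)) => [E|[c0 c0S]].
  have Ea : above w =i predT.
    by move=> c; rewrite !inE; apply/forallP => d; rewrite E inE.
  by move: lt; rewrite /n_above (eq_card Ea) card_ord; lia.
case: (arg_maxnP (fun c : 'I_k => val c) c0S) => m mS mmax.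
exists m => //.
apply: (@leq_trans (codeg w - n_above w)); first by have := deg_codeg w; lia.
rewrite leq_subLR; apply: leq_trans (leq_card_setU _ _); apply: subset_leq_card.
apply/fintype.subsetP => c; rewrite !inE => cS; rewrite cS /=.
case: (ltnP c m) => cm; rewrite ?orbT ?orbF //.
apply/forallP => d; apply/implyP => dS.
have dm : d <= m := mmax d dS.
have ne : val d != val c by apply: contraNneq cS => /val_inj <-.
by move: ne dm cm => /=; lia.
Qed.

(** A color missing at [par u] must occur at [u], hence any color above all of [S u] exceeds it. *)
Lemma above_top u : R u -> n_above u <= n_top (par u).
Proof.
move=> Ru; apply: subset_leq_card; apply/fintype.subsetP => c.
rewrite !inE => /forallP H; apply/forallP => d; apply/implyP => dS.
apply: (implyP (H d)); have := FF_rejected d Ru; rewrite finset.in_setU.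
by rewrite !inE in dS; rewrite (negbTE dS) orbF.
Qed.

Let X_deg w := X w + \sum_(x | X x && (par x == w)) 1.

(** The optimum has at most [k] edges at [w]; they include the rejected edges and the colored edges
    outside [X]. *)
Lemma rejected_degree w :
  \sum_(u | R u && (par u == w)) 1 + deg w <= k + X_deg w.
Proof.
have := max_card (palette opt w); rewrite card_ord.
rewrite -sum1_card -(palette_sum w (fun=> 1)) // (star_split _ _ opt_ok) //.
rewrite card_palette /X_deg.
have splitO : \sum_(x | opt x && (par x == w)) 1 =
    \sum_(x | R x && (par x == w)) 1 + \sum_(x | [&& opt x, col x & par x == w]) 1.
  rewrite (bigID (fun x => ~~ col x)) /=; congr (_ + _); apply: eq_bigl => x.
    by rewrite /R -!andbA [~~ _ && _]andbC.
  by rewrite negbK -andbA [(_ == _) && _]andbC.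
have splitF : \sum_(x | F x && (par x == w)) 1 =
    \sum_(x | X x && (par x == w)) 1 + \sum_(x | [&& opt x, col x & par x == w]) 1.
  rewrite (bigID (fun x => ~~ opt x)) /=; congr (_ + _); apply: eq_bigl => x.
    by rewrite /X -!andbA [~~ _ && _]andbC.
  by rewrite negbK andbC.
by rewrite splitO splitF /F /X; case: (opt w) => [?|]; case: (col w) => [?|] /=; lia.
Qed.

(* The coins of the colored edges below [z], and the extra coins of the edge of
   [z] itself if the optimum does not color it. *)
Lemma charge_up z :
  (if R z then deg z else 0) + (if F z then below (par z) (col z) else 0)
    + (if X z then (deg z).-1 + (deg (par z)).-1 else 0)
  <= \sum_(x | F x && (par x == z)) 1 + (if X z then k.-1 else 0).
Proof.
have := card_palette z; rewrite /R /X /F; case E: (col z) => [c|] /=.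
  move=> bz.
  have pz : 0 < deg (par z).
    by apply/card_gt0P; exists c; apply: (mem_palette _ E); rewrite !inE eqxx orbT.
  have := deg_codeg (par z).
  (* [b1], combined with [deg_codeg], settles the edges of [X]; [b2], which comes from First-Fit,
     settles the edges colored by both. *)
  have b1 : below (par z) (Some c) <= codeg (par z).
    by apply: subset_leq_card; apply/fintype.subsetP=> d; rewrite !inE => /andP[].
  have b2 : below (par z) (Some c) <= #|S z :\ c|.
    apply: subset_leq_card; apply/fintype.subsetP=> d; rewrite !inE => /andP[dS dc].
    have := FF_colored E dc; rewrite finset.in_setU (negbTE dS) orbF => ->.
    by rewrite andbT; apply: contraTneq dc => ->; rewrite ltnn.
  have b3 : deg z = 1 + #|S z :\ c|.
    have cz : c \in S z by apply: (mem_palette _ E); rewrite !inE eqxx.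
    by rewrite /deg (cardsD1 c (S z)) cz.
  by case: (opt z) => [?|] /=; lia.
by case: (opt z) => [?|] /=; lia.
Qed.

(* What is lacking to pay for the edge of [w] and for the edges of the children
   of [w], against the coins that [w] receives. *)
Lemma charge_down w :
  (if R w then k - deg w - n_above w else 0)
    + \sum_(u | R u && (par u == w)) (n_above u).-1
  <= \sum_(x | F x && (par x == w)) below w (col x) + X_deg w * (deg w).-1.
Proof.
(* At most [codeg w + X_deg w] children have rejected edges; the coins of [X] cover the share of
   [X_deg w], as [n_top w <= deg w]. *)
have rej : \sum_(u | R u && (par u == w)) (n_above u).-1 <=
    codeg w * (n_top w).-1 + X_deg w * (deg w).-1.
  apply: (@leq_trans (\sum_(u | R u && (par u == w)) 1 * (n_top w).-1)).
    apply: leq_sum => u /andP[Ru /eqP <-]; rewrite mul1n.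
    by have := above_top Ru; lia.
  rewrite -big_distrl /=.
  have := rejected_degree w; have := deg_codeg w.
  have le1 : n_top w <= deg w := subset_leq_card (top_sub w).
  set r := \sum_(_ | _) 1 => e1 le2; have le3 : r <= codeg w + X_deg w by lia.
  apply: (leq_trans (leq_mul le3 (leqnn _))); rewrite mulnDl leq_add2l.
  by apply: leq_mul => //; lia.
suff : (if R w then k - deg w - n_above w else 0) + codeg w * (n_top w).-1 <=
    \sum_(x | F x && (par x == w)) below w (col x) by lia.
have sumS := palette_sum w (below w) col_ok.
rewrite (star_split _ _ col_ok) // in sumS.
(* If the edge of [w] is colored, the coins come from the other colors at [w], and its own color is
   the one left out in [below_sum]. *)
rewrite /R /F in sumS *; case E: (col w) sumS => [c|] /=; rewrite ?andbF ?andbT => sumS.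
  rewrite (bigD1 c) /= in sumS; last first.
    by apply: (mem_palette _ E); rewrite !inE eqxx.
  by rewrite add0n (addnI sumS); exact: below_sum.
rewrite add0n in sumS; rewrite sumS.
have triv : codeg w * (n_top w).-1 <= \sum_(c in palette col w) below w (Some c).
  case: (finset.set_0Vmem (S w)) => [E0|[c cS]].
    suff -> : n_top w = 0 by rewrite muln0.
    by apply/eqP; rewrite -leqn0 -(cards0 'I_k) -E0; exact: subset_leq_card (top_sub w).
  apply: (leq_trans (below_sum w c)); rewrite [leqRHS](bigD1 c) //=; exact: leq_addl.
case: ifP => // _.
(* The color [m] pays for the rejected edge of [w], the remaining colors for the edges of its
   children. *)
case: (ltnP (n_above w + deg w) k) => [/below_self[m mS mle]|le_k]; last first.
  have -> : k - deg w - n_above w = 0 by lia.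
  by rewrite add0n.
by rewrite (bigD1 m) //= leq_add ?below_sum.
Qed.

(** Summed over all vertices, the coins handed over in [charge_up] and received in [charge_down]
    cancel, leaving [(k - 1) |R| <= |F| + (k - 1) |X|]. *)
Lemma charging : k.-1 * \sum_(x | opt x) 1 <= k * \sum_(x | col x) 1.
Proof.
have up := leq_sum (index_enum V) (fun z (_ : true) => charge_up z).
have down := leq_sum (index_enum V) (fun z (_ : true) => charge_down z).
move: up down; rewrite !big_split /= -!big_mkcond /=.
have part (P : pred V) (g : V -> nat) :
    \sum_w \sum_(x | P x && (par x == w)) g x = \sum_(x | P x) g x.
  by rewrite [RHS](partition_big par xpredT).
rewrite !part.
have -> : \sum_w \sum_(x | F x && (par x == w)) below w (col x) =
    \sum_(x | F x) below (par x) (col x).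
  rewrite -[RHS]part; apply: eq_bigr => w _.
  by apply: eq_bigr => x /andP[_ /eqP ->].
have -> : \sum_w X_deg w * (deg w).-1 =
    \sum_(x | X x) (deg x).-1 + \sum_(x | X x) (deg (par x)).-1.
  rewrite -(part X (fun x => (deg (par x)).-1)) [X in _ = X + _]big_mkcond.
  rewrite -big_split /=.
  apply: eq_bigr => w _; rewrite /X_deg mulnDl big_distrl /=; congr (_ + _).
    by case: (X w); rewrite ?mul1n.
  by apply: eq_bigr => x /andP[_ /eqP ->]; rewrite mul1n.
(* A rejected edge is paid from the edges below it, by its lower endpoint and by its upper
   endpoint. *)
have rej : \sum_(x | R x) k.-1 <= \sum_(x | R x) deg x +
    \sum_(x | R x) (k - deg x - n_above x) + \sum_(x | R x) (n_above x).-1.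
  by rewrite -!big_split; apply: leq_sum => x _ /=; lia.
have cst (P : pred V) : \sum_(x | P x) k.-1 = k.-1 * \sum_(x | P x) 1.
  by rewrite big_distrr /=; apply: eq_bigr => x _; rewrite muln1.
rewrite !cst in rej *.
have -> : \sum_(x | opt x) 1 = \sum_(x | R x) 1 + \sum_(x | opt x && col x) 1.
  rewrite (bigID (fun x => ~~ col x)) /=; congr (_ + _).
  by apply: eq_bigl => x; rewrite negbK.
have -> : \sum_(x | col x) 1 = \sum_(x | X x) 1 + \sum_(x | opt x && col x) 1.
  rewrite (bigID (fun x => ~~ opt x)) /=; congr (_ + _).
  by apply: eq_bigl => x; rewrite negbK andbC.
rewrite big_split /=; move: rej.
set r := \sum_(x | R x) 1; set n := \sum_(x | X x) 1; set m := \sum_(x | _ && _) 1.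
move=> rej up down.
have rn : k.-1 * r <= n + m + k.-1 * n by lia.
by case: (posnP k) => [-> //|k_gt0]; have := prednK k_gt0; nia.
Qed.

End Charging.

(** * Orienting a forest *)

Lemma linked_sym (s : seq edge) : symmetric (linked s).
Proof. by move=> u v; rewrite /linked fsetUC. Qed.

Lemma linked_irr (s : seq edge) u v : is_simple s -> linked s u v -> u != v.
Proof.
case/andP=> _ /allP H /H; rewrite cardfs2.
by apply: contraTneq => ->; rewrite eqxx.
Qed.

Lemma simple_edge (s : seq edge) e : is_simple s -> e \in s ->
  exists u v : nat, e = [fset u; v]%fset.
Proof.
case/andP=> _ /allP H /H /eqP e2.
have [u ue] : exists u, u \in e by apply/fset0Pn; rewrite -cardfs_gt0 e2.
have : #|` (e `\ u)%fset| == 1 by move: e2; rewrite (cardfsD1 u) ue => -[e1]; apply/eqP.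
by case/cardfs1P=> v ev; exists u, v; rewrite -(fsetD1K ue) ev.
Qed.

Lemma acyclic_sub (s t : seq edge) :
  {subset s <= t} -> is_acyclic t -> is_acyclic s.
Proof.
move=> st ac c c2 /andP[cc cu]; apply: (ac c c2); rewrite /ucycle cu andbT.
case: c cc {c2 cu} => //= x p; apply: sub_path => u v; exact: st.
Qed.

(** Otherwise every path could be extended at its start: a further neighbor off the path lengthens
    it, one on the path closes a cycle. Paths would outgrow the list of all endpoints. *)
Lemma exists_leaf (s : seq edge) : is_simple s -> is_acyclic s -> s != [::] ->
  exists x y, linked s x y /\ forall z, linked s x z -> z = y.
Proof.
move=> simp ac s0; apply: contrapT => noleaf.
have next x y : linked s x y -> exists2 z, linked s x z & z != y.
  move=> xy; apply: contrapT => no; apply: noleaf; exists x, y; split=> // z xz.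
  by apply/eqP; apply: contrapT => /negP zy; apply: no; exists z.
have long n : exists x p, [/\ path (linked s) x p, uniq (x :: p) & size p = n.+1].
  elim: n => [|n [x [[|y p] [//= /andP[xy yp] /andP[xnp pu] [pn]]]]].
    case: s s0 simp {ac noleaf next} => // e s _ simp.
    have [u [v euv]] := simple_edge simp (mem_head e s).
    have uv : linked (e :: s) u v by rewrite /linked -euv mem_head.
    by exists u, [:: v]; rewrite /= uv inE (linked_irr simp uv).
  have [z xz zy] := next x y xy.
  case: (boolP (z \in x :: y :: p)) => [|zn]; last first.
    exists z, (x :: y :: p).
    by rewrite /= [linked s z x]linked_sym xz xy yp zn xnp pu pn.
  rewrite inE eq_sym (negbTE (linked_irr simp xz)) inE (negbTE zy) /= => zp.
  case/splitPr: zp xnp yp pu {pn} => p1 p2; rewrite -cat_rcons => xnp yp pu.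
  exfalso; apply: (ac (x :: y :: rcons p1 z)); first by rewrite /= size_rcons.
  move: yp; rewrite cat_path => /andP[yp1 _].
  rewrite /ucycle /= xy [path _ _ (rcons (rcons _ _) _)]rcons_path yp1 last_rcons.
  rewrite [linked s z x]linked_sym xz /=.
  move: xnp pu; rewrite -!cat_cons mem_cat negb_or /= cat_uniq mem_cat negb_or.
  by move=> /andP[-> _] /andP[/andP[-> _] /andP[-> _]].
pose vs : seq nat := flatten [seq enum_fset e | e <- s].
have [x [p [xp /andP[_ pu] pn]]] := long (size vs).
have : size p <= size vs.
  apply: uniq_leq_size => // v vp.
  suff [e es ve] : exists2 e : edge, e \in s & v \in e.
    by apply/flattenP; exists (enum_fset e) => //; apply: map_f.
  elim: p x xp vp {pu pn} => //= y p IH x /andP[xy yp].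
  rewrite inE => /predU1P[->|/(IH y yp) //].
  by exists [fset x; y]%fset => //; rewrite !inE eqxx orbT.
by rewrite pn ltnn.
Qed.

(* No edge is oriented both ways, so the oriented edges [v -> par v] are the
   edges of the graph, each counted once. *)
Lemma orientation (s : seq edge) : is_simple s -> is_acyclic s ->
  exists par : nat -> nat,
    [/\ forall v, par v != v -> [fset v; par v]%fset \in s,
        forall e, e \in s -> exists2 v, par v != v & e = [fset v; par v]%fset
      & forall v, par v != v -> par (par v) != v].
Proof.
elim: {s}(size s) {-2}s (erefl (size s)) => [|n IH] s sn simp ac.
  by case: s sn {simp ac} => // _; exists id; split=> // v; rewrite eqxx.
have s0 : s != [::] by case: s sn {simp ac}.
have [x [y [xy leaf]]] := exists_leaf simp ac s0.
(* Without its only edge, [x] is isolated in [t], thus neither a child nor a parent there, and can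
   be hung below [y]. *)
pose t := rem ([fset x; y]%fset : edge) s.
have us : uniq s by case/andP: simp.
have ts : {subset t <= s} by apply: mem_rem.
have tn : size t = n by rewrite size_rem // sn.
have simpt : is_simple t.
  rewrite /is_simple rem_uniq //; apply/allP => e /ts.
  by case/andP: simp => _ /allP; apply.
have [par [P1 P2 P3]] := IH t tn simpt (acyclic_sub ts ac).
have xt v : ~~ linked t x v.
  apply/negP => xv; have /leaf E := ts _ xv.
  by move: xv; rewrite /linked E mem_rem_uniq // !inE eqxx.
have parx : par x = x.
  apply/eqP; apply: contraT => /P1.
  by rewrite -[_ \in _]/(linked t _ _) (negbTE (xt _)).
have nparx v : par v = x -> v = x.
  move=> pv; apply/eqP; apply: contraT => vx.
  have : linked t v x by rewrite -pv; apply: P1; rewrite pv eq_sym.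
  by rewrite linked_sym (negbTE (xt _)).
have yx : y != x by rewrite eq_sym (linked_irr simp xy).
exists (fun v => if v == x then y else par v); split=> [v|e es|v].
- by case: (eqVneq v x) => [-> _|_ pv]; [exact: xy | exact: ts (P1 v pv)].
- case: (eqVneq e [fset x; y]%fset) => [->|exy].
    by exists x; rewrite eqxx.
  have et : e \in t by rewrite mem_rem_uniq // inE exy.
  have [v vp ev] := P2 _ et.
  have vx : v != x by apply: contraNneq vp => ->; rewrite parx.
  by exists v; rewrite (negbTE vx).
- case: (eqVneq v x) => [->|vx] pv.
    rewrite (negbTE yx); apply: contraNneq yx => /nparx ->; by [].
  rewrite (negbTE (_ : par v != x)); first exact: P3.
  by apply: contra_neq vx => /nparx.
Qed.

(** * First-Fit *)

Section Histories.

Variable k : nat.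
Implicit Types (A : algorithm k) (h g : history k) (s t : seq edge) (e : edge).

Lemma run_rcons A s e : run A (rcons s e) = rcons (run A s) (e, A (run A s) e).
Proof. by rewrite /run -cats1 foldl_cat. Qed.

Lemma unzip1_run A s : unzip1 (run A s) = s.
Proof.
by elim/last_ind: s => // s e IH; rewrite run_rcons /unzip1 map_rcons -/(unzip1 _) IH.
Qed.

Lemma run_cat A s t : exists2 g, run A (s ++ t) = run A s ++ g & unzip1 g = t.
Proof.
elim/last_ind: t => [|t e [g IH gt]]; first by exists [::]; rewrite ?cats0.
exists (rcons g (e, A (run A s ++ g) e)); last by rewrite -gt /unzip1 map_rcons.
by rewrite -rcons_cat run_rcons IH rcons_cat.
Qed.

Lemma compatible_sym : symmetric (@compatible k).
Proof.
move=> [e1 [c1|]] [e2 [c2|]]; rewrite /compatible /= fdisjoint_sym ?orbT //.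
by rewrite eq_sym.
Qed.

Lemma incompatible e e' (c : 'I_k) a :
  ~~ compatible (e, Some c) (e', a) -> a = Some c /\ exists2 v, v \in e & v \in e'.
Proof.
rewrite /compatible /= negb_or negbK => /andP[/fdisjointP dis /eqP <-]; split=> //.
apply: contrapT => no; apply: dis => v ve; apply/negP => ve'; apply: no; by exists v.
Qed.

Lemma proper_inj h v e e' (c : 'I_k) : proper_coloring h ->
  (e, Some c) \in h -> (e', Some c) \in h -> v \in e -> v \in e' -> e = e'.
Proof.
move=> ph eh e'h ve ve'.
have clash f f' : v \in f -> v \in f' -> ~~ compatible (f, Some c) (f', Some c).
  rewrite /compatible /= eqxx orbF => vf vf'.
  by apply/negP => /fdisjointP/(_ v vf); rewrite vf'.
elim: h ph eh e'h => //= x h IH /andP[/allP xh ph].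
rewrite !inE => /predU1P[ex|eh] /predU1P[e'x|e'h]; last exact: IH.
- by move: e'x; rewrite -ex => -[].
- by have := xh _ e'h; rewrite -ex (negbTE (clash _ _ ve ve')).
- by have := xh _ eh; rewrite -e'x (negbTE (clash _ _ ve' ve)).
Qed.

Definition color_in h e : option 'I_k := nth None (unzip2 h) (index e (unzip1 h)).

Lemma color_inP h e : e \in unzip1 h -> (e, color_in h e) \in h.
Proof.
rewrite /color_in; elim: h => //= -[e' a] h IH; rewrite !inE /=.
rewrite [e' == e]eq_sym; case: (eqVneq e e') => [-> _|_ /= eh]; first by rewrite eqxx.
by rewrite IH // orbT.
Qed.

Lemma color_in_mem h e a : uniq (unzip1 h) -> (e, a) \in h -> color_in h e = a.
Proof.
rewrite /color_in; elim: h => //= -[e' a'] h IH /andP[e'h uh]; rewrite !inE /=.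
case/predU1P => [[-> ->]|eh]; first by rewrite eqxx.
case: eqVneq => [e'e|_]; last exact: IH.
by case/negP: e'h; rewrite e'e; apply/mapP; exists (e, a).
Qed.

Lemma num_colored_sum h : uniq (unzip1 h) ->
  num_colored h = \sum_(e <- unzip1 h | color_in h e) 1.
Proof.
move=> uh; rewrite /num_colored -sum1_count big_map.
rewrite [LHS]big_seq_cond [RHS]big_seq_cond; apply: eq_bigl => -[e a] /=.
by case: (boolP (_ \in h)) => //= /(color_in_mem uh) ->.
Qed.

Lemma proper_run_first_fit s : proper_coloring (run (first_fit k) s).
Proof.
elim/last_ind: s => // s e IH; rewrite run_rcons /proper_coloring pairwise_rcons.
rewrite -/(proper_coloring _) IH andbT; set h := run _ _.
rewrite /first_fit; set cs := [seq c <- _ | _].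
have : {subset cs <= [pred c | all (compatible (e, Some c)) h]}.
  by move=> c; rewrite mem_filter => /andP[].
case: cs => [_|c cs /(_ c (mem_head _ _)) /= /allP ch]; apply/allP => x xh.
  by case: x xh => f [c|] _; rewrite /compatible /= orbT.
by rewrite compatible_sym; apply: ch.
Qed.

(** First-Fit takes the head of the increasing list of admissible colors; a smaller color, or any
    color upon rejection, is not in that list and so clashes with an earlier edge. *)
Lemma first_fit_blocked s e a (c : 'I_k) :
  (e, a) \in run (first_fit k) s -> (if a is Some d then c < d else true) ->
  exists e', (e', Some c) \in run (first_fit k) s /\ exists2 v, v \in e & v \in e'.
Proof.
elim/last_ind: s => // s f IH; rewrite run_rcons mem_rcons inE.
set h := run _ s in IH *.
have lift x : (exists e', (e', Some c) \in h /\ exists2 v, v \in e & v \in e') ->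
    exists e', (e', Some c) \in rcons h x /\
               exists2 v, v \in e & v \in e'.
  by case=> e' [e'h ve]; exists e'; rewrite mem_rcons inE e'h orbT.
case/predU1P => [[<- ->] ca|eh ca]; last by apply/lift/IH.
apply: lift.
suff : ~~ all (compatible (e, Some c)) h.
  case/allPn => -[e' b] e'h /incompatible[bc ve]; exists e'; by rewrite -bc.
move: ca; rewrite /first_fit; set cs := [seq c <- _ | _] => ca.
have : c \notin cs.
  have : sorted (fun c d : 'I_k => c < d) cs.
    apply: sorted_filter; first by move=> ? ? ?; apply: ltn_trans.
    rewrite -[sorted _ _]/(sorted (relpre val ltn) _) -sorted_map val_enum_ord.
    exact: iota_ltn_sorted.
  case: cs ca => //= d cs cd.
  rewrite path_sortedE; last by move=> ? ? ?; apply: ltn_trans.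
  case/andP=> /allP dcs _; rewrite inE negb_or.
  apply/andP; split; first by apply: contraTneq cd => ->; rewrite ltnn.
  by apply/negP => /dcs; move: cd; lia.
by rewrite mem_filter mem_enum andbT.
Qed.

End Histories.

(** * Histories as colorings of a rooted forest *)

Section RootedHistory.

Variables (k N : nat) (s : seq edge) (par : nat -> nat).
Hypothesis s_uniq : uniq s.
Hypothesis s_lt : forall (e : edge) (v : nat), e \in s -> v \in e -> v < N.+1.
Hypothesis par_edge : forall v, par v != v -> [fset v; par v]%fset \in s.
Hypothesis edge_par : forall e : edge, e \in s ->
  exists2 v, par v != v & e = [fset v; par v]%fset.
Hypothesis par_asym : forall v, par v != v -> par (par v) != v.

(** The charging needs a finite vertex type. [inord] preserves the value here, as a parent is the
    vertex itself or an endpoint bounded by [s_lt]. *)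
Definition ord_par (v : 'I_N.+1) : 'I_N.+1 := inord (par v).

Lemma ord_parE v : val (ord_par v) = par v.
Proof.
rewrite /= inordK //; case: (eqVneq (par v) v) => [->|/par_edge] //.
by move/s_lt; apply; rewrite !inE eqxx orbT.
Qed.

Definition up_edge (v : nat) : edge := [fset v; par v]%fset.

Definition up_color (h : history k) (v : 'I_N.+1) : option 'I_k :=
  if ord_par v == v then None else color_in h (up_edge v).

Lemma ord_par_neq v : (ord_par v != v) = (par v != v).
Proof. by rewrite -val_eqE ord_parE. Qed.

(** Distinct vertices with the same edge would be parents of each other, against [par_asym]. *)
Lemma up_edge_inj u v : par u != u -> par v != v -> up_edge u = up_edge v -> u = v.
Proof.
move=> pu pv E; have : u \in up_edge v by rewrite -E !inE eqxx.
rewrite !inE => /predU1P[//|/eqP uv].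
have : v \in up_edge u by rewrite E !inE eqxx.
rewrite !inE => /predU1P[//|/eqP vu].
by have := par_asym pu; rewrite -vu -uv eqxx.
Qed.

Lemma mem_up_edge (w v : 'I_N.+1) : (val w \in up_edge v) = (v \in star ord_par w).
Proof.
by rewrite !inE -!val_eqE ord_parE eq_sym [par _ == _]eq_sym.
Qed.

Lemma up_colorP h v c : unzip1 h = s -> up_color h v = Some c ->
  par v != v /\ (up_edge v, Some c) \in h.
Proof.
move=> hs; rewrite /up_color; case: ifP => // /negbT; rewrite ord_par_neq => pv cv.
by split=> //; rewrite -cv; apply: color_inP; rewrite hs; exact: par_edge.
Qed.

Lemma up_color_rooted h : unzip1 h = s -> proper_coloring h ->
  rooted_coloring ord_par (up_color h).
Proof.
move=> hs ph; split=> [v|w x y c].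
  by rewrite /up_color; case: ifP.
rewrite -!mem_up_edge => xw yw /(up_colorP hs)[px xc] /(up_colorP hs)[py yc].
by apply/val_inj/up_edge_inj => //; exact: proper_inj ph xc yc xw yw.
Qed.

Lemma num_colored_up_color h : unzip1 h = s ->
  num_colored h = \sum_(v | up_color h v) 1.
Proof.
move=> hs; rewrite num_colored_sum ?hs //.
pose r := [seq v : 'I_N.+1 <- enum 'I_N.+1 | par v != v].
have r_par (v : 'I_N.+1) : v \in r = (par v != v) by rewrite mem_filter mem_enum andbT.
have perm : perm_eq s [seq up_edge (val v) | v <- r].
  apply: uniq_perm => //.
    rewrite map_inj_in_uniq; first exact: filter_uniq (enum_uniq _).
    move=> u v.
    by rewrite !r_par => pu pv /(up_edge_inj pu pv)/val_inj.
  move=> e; apply/idP/mapP => [es|[v vr ->]]; last by apply: par_edge; rewrite -r_par.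
  have [v pv ev] := edge_par es.
  have vN : v < N.+1 by apply: (s_lt es); rewrite ev !inE eqxx.
  by exists (Ordinal vN) => //; rewrite r_par.
rewrite (perm_big _ perm) big_map big_filter_cond big_enum_cond /=.
apply: eq_bigl => v; rewrite /up_color -[par v != v]ord_par_neq.
by case: eqVneq.
Qed.

(** Turns a clash between two edges of the history into the form of the hypotheses of [charging]. *)
Lemma palette_up_color h v (w : 'I_N.+1) e c : unzip1 h = s ->
  (e, Some c) \in h -> v \in e -> v \in up_edge w ->
  c \in palette ord_par (up_color h) w :|: palette ord_par (up_color h) (ord_par w).
Proof.
move=> hs eh ve vw.
have es : e \in s by rewrite -hs; apply/mapP; exists (e, Some c).
have [x px ex] := edge_par es.
have xN : x < N.+1 by apply: (s_lt es); rewrite ex !inE eqxx.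
pose x' := Ordinal xN.
have cx : up_color h x' = Some c.
  rewrite /up_color ifN ?ord_par_neq // /up_edge -ex.
  by apply: color_in_mem; rewrite ?hs.
have vN : v < N.+1 by apply: (s_lt es).
have xs (z : 'I_N.+1) : val z = v -> x' \in star ord_par z.
  by move=> zv; rewrite -mem_up_edge zv /up_edge -ex.
rewrite finset.in_setU; apply/orP.
move: vw; rewrite !inE => /predU1P[vw|/eqP vw]; [left|right].
  by apply: (mem_palette _ cx); apply: xs.
by apply: (mem_palette _ cx); apply: xs; rewrite ord_parE.
Qed.

Lemma first_fit_rooted (g : history k) : unzip1 g = s -> proper_coloring g ->
  k.-1 * num_colored g <= k * num_colored (run (first_fit k) s).
Proof.
move=> gs pg; set h := run _ _; have hs : unzip1 h = s := unzip1_run _ _.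
rewrite (num_colored_up_color gs) (num_colored_up_color hs).
apply: (@charging _ _ ord_par); try exact: up_color_rooted.
- exact: up_color_rooted hs (proper_run_first_fit _ _).
- move=> x c c' xc c'c; have [px xh] := up_colorP hs xc.
  have [e' [e'h [v vx ve']]] := first_fit_blocked xh c'c.
  exact: palette_up_color hs e'h ve' vx.
- move=> x c /andP[gx hx].
  have px : par x != x by move: gx; rewrite /up_color -ord_par_neq; case: ifP.
  have xh : (up_edge x, None) \in h.
    have <- : color_in h (up_edge x) = None.
      by move: hx; rewrite /up_color ifN ?ord_par_neq //; case: (color_in _ _).
    by apply: color_inP; rewrite hs; exact: par_edge.
  have [e' [e'h [v vx ve']]] := first_fit_blocked (c := c) xh isT.
  exact: palette_up_color hs e'h ve' vx.
Qed.

End RootedHistory.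

Lemma first_fit_tree k s : is_tree s ->
  k.-1 * OPT k s <= k * ALG (first_fit k) s.
Proof.
case=> simp _ ac; have [par [P1 P2 P3]] := orientation simp ac.
have [N sN] : exists N, forall e v, e \in s -> v \in e -> v < N.+1.
  exists (\max_(e <- s) \max_(v <- enum_fset e) v) => e v es ve; rewrite ltnS.
  apply: (@leq_trans (\max_(v <- enum_fset e) v)).
    by rewrite (big_rem v) //= leq_maxl.
  by rewrite (big_rem e) //= leq_maxl.
have us : uniq s by case/andP: simp.
rewrite /OPT; elim/big_ind: _ => [|x y xs ys|c pc]; first by rewrite muln0.
  by rewrite /maxn; case: ifP.
apply: (first_fit_rooted us sN P1 P2 P3) => //.
by rewrite unzip1_zip // size_tuple.
Qed.

(** * The adversary *)

Lemma linked_path_sym (s : seq edge) u v :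
  (exists2 p, path (linked s) u p & last u p = v) ->
  exists2 p, path (linked s) v p & last v p = u.
Proof.
case=> p up <-; exists (rev (belast u p)); last first.
  by case: p {up} => //= x p; rewrite rev_cons last_rcons.
by rewrite -rev_path in up; rewrite (eq_path (linked_sym s)).
Qed.

Lemma tree_rcons (s : seq edge) (v j : nat) : is_tree s ->
  s = [::] \/ is_vertex s v -> ~~ is_vertex s j -> v != j ->
  is_tree (rcons s [fset v; j]%fset).
Proof.
move=> [simp conn ac] sv sj vj; set e : edge := [fset v; j]%fset.
have ej f : f \in s -> j \notin f.
  by move=> fs; apply: contra sj => jf; apply/hasP; exists f.
have es : e \notin s by apply/negP => /ej; rewrite !inE eqxx orbT.
have simp' : is_simple (rcons s e).
  case/andP: simp => us alls.
  by rewrite /is_simple rcons_uniq es us all_rcons alls cardfs2 vj.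
split=> //.
- have to_v u : is_vertex (rcons s e) u ->
      exists2 p, path (linked (rcons s e)) u p & last u p = v.
    rewrite /is_vertex has_rcons !inE -orbA => /or3P[/eqP->|/eqP->|us].
    + by exists [::].
    + by exists [:: v] => //=; rewrite /linked fsetUC mem_rcons mem_head.
    + case: sv => [s0|vs]; first by rewrite s0 in us.
      have [p up pv] := conn _ _ us vs; exists p => //.
      by apply: sub_path up => x y xy; rewrite /linked mem_rcons inE [_ \in s]xy orbT.
  move=> u w /to_v[p up pv] /to_v/linked_path_sym[q vq qw].
  by exists (p ++ q); rewrite ?cat_path ?last_cat pv ?up.
- have linked_j a : linked (rcons s e) j a -> a = v.
    rewrite /linked mem_rcons inE => /predU1P[E|/ej]; last by rewrite !inE eqxx.
    have : v \in ([fset j; a]%fset : edge) by rewrite E !inE eqxx.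
    by rewrite !inE (negbTE vj) => /eqP.
  (* On a cycle through [j] both neighbors of [j] would be [v], so [v] would be repeated; any other
     cycle lies in [s]. *)
  move=> c c2 cc; case: (boolP (j \in c)) => [/rot_to[i q iq]|jc].
    move: cc c2; rewrite -(rot_ucycle i) -(size_rot i) iq.
    case: q {iq} => // a [//|b q] /andP[/= cc /andP[_ /andP[aq _]]] _.
    case/andP: cc => /linked_j av /andP[_]; rewrite rcons_path => /andP[_].
    rewrite linked_sym => /linked_j lv.
    by move: aq; rewrite av -lv mem_last.
  apply: (ac c c2); case/andP: cc => cc cu; rewrite /ucycle cu andbT.
  apply: (sub_in_cycle (P := predC1 j)) cc => [x y xj yj|].
    rewrite /linked mem_rcons inE => /predU1P[E|//].
    have : j \in ([fset x; y]%fset : edge) by rewrite E !inE eqxx orbT.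
    by rewrite !inE eq_sym (negbTE xj) eq_sym (negbTE yj).
  by apply/allP => x xc; apply: contraNneq jc => <-.
Qed.

Lemma tree_star (s : seq edge) (v : nat) (js : seq nat) : is_tree s ->
  s = [::] \/ is_vertex s v -> uniq (v :: js) ->
  {in js, forall j, ~~ is_vertex s j} ->
  is_tree (s ++ [seq [fset v; j]%fset | j <- js]).
Proof.
move=> ts sv; elim/last_ind: js => [|js j IH]; first by rewrite cats0.
rewrite map_rcons -rcons_cat -rcons_cons rcons_uniq inE negb_or.
case/andP=> /andP[jv jjs] ujs fresh; apply: tree_rcons; last by rewrite eq_sym.
- by apply: IH => // i ijs; apply: fresh; rewrite mem_rcons inE ijs orbT.
- case: js {IH jjs ujs fresh} => [|i js] /=; first by rewrite cats0.
  by right; rewrite /is_vertex has_cat /= !inE eqxx orbT.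
- rewrite /is_vertex has_cat negb_or fresh ?mem_rcons ?mem_head //=.
  apply/hasPn => f /mapP[i ijs ->]; rewrite !inE negb_or jv.
  by apply: contraNneq jjs => ->.
Qed.

Section Adversary.

Variable k : nat.
Implicit Types (A : algorithm k) (h g : history k) (s t : seq edge) (v : nat).

Definition colored_at v h : nat := count (fun x => (v \in x.1) && isSome x.2) h.

Lemma colored_at_le v h : proper_coloring h -> colored_at v h <= k.
Proof.
move=> ph; pose P (x : edge * option 'I_k) := (v \in x.1) && isSome x.2.
have -> : colored_at v h = size (map snd [seq x <- h | P x]).
  by rewrite size_map size_filter.
have sk : size (map Some (enum 'I_k)) = k by rewrite size_map size_enum_ord.
rewrite -[leqRHS]sk; apply: uniq_leq_size; last first.
  move=> a /mapP[[e [c|]]]; rewrite mem_filter /P /= ?andbF // => _ ->.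
  by apply: map_f; rewrite mem_enum.
rewrite uniq_pairwise pairwise_map.
have : pairwise (@compatible k) [seq x <- h | P x] by apply: pairwise_filter.
have : all P [seq x <- h | P x] by apply: filter_all.
elim: [seq x <- h | P x] => //= x r IH /andP[Px Pr] /andP[xr r_pw].
rewrite IH // andbT; apply/allP => y yr /=.
have /andP[vy _] := allP Pr _ yr; have /andP[vx x2] := Px.
have := allP xr _ yr; rewrite /compatible.
case/or3P => // [/fdisjointP/(_ v vx)|/eqP x0]; first by rewrite vy.
by rewrite x0 in x2.
Qed.

Lemma OPT_ge g : proper_coloring g -> num_colored g <= OPT k (unzip1 g).
Proof.
move=> pg; have sz : size (unzip2 g) == size (unzip1 g) by rewrite !size_map.
have := @leq_bigmax_cond _ (fun c : (size (unzip1 g)).-tuple (option 'I_k) =>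
  proper_coloring (zip (unzip1 g) c))
  (fun c => num_colored (zip (unzip1 g) c)) (Tuple sz).
by rewrite /= zip_unzip; apply.
Qed.

Hypothesis k_ge2 : 2 <= k.

(* The spine moves on from [v] to a leaf whose edge was colored, if any. So at
   most [k - 1] leaf edges are colored at a spine vertex reached through a colored
   edge, and a vertex reached through a rejected edge compensates for its
   predecessor, none of whose leaf edges was colored. The coloring [g] leaves out
   the spine. *)
Lemma caterpillar A (i : nat) : tree_algorithm A ->
  exists s v N g,
    [/\ is_tree s, s = [::] \/ is_vertex s v,
        v < N /\ (forall u, is_vertex s u -> u < N),
        ALG A s <= k.-1 * i + (0 < colored_at v (run A s))
      & [/\ unzip1 g = s, proper_coloring g,
            forall x, x \in g -> v \in x.1 -> x.2 = None
          & k * i <= num_colored g]].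
Proof.
move=> hA; elim: i => [|i [s [v [N [g [ts sv [vN sN] algs [gs pg gv gi]]]]]]].
  have t0 : is_tree [::] by split=> // -[//|x [//|y p]] _ /andP[/andP[]].
  by exists [::], 0, 1, [::]; split=> //; [left | split=> //; rewrite muln0].
(* Of the [k + 1] pendant edges one continues the spine and [g] colors the other [k]. Labels from
   [N] on are fresh. *)
pose E (m : 'I_k.+1) : edge := [fset v; (N + m)%N]%fset.
pose t := map E (enum 'I_k.+1).
have tst : is_tree (s ++ t).
  have -> : t = [seq [fset v; j]%fset |
      j <- [seq N + val m | m : 'I_k.+1 <- enum 'I_k.+1]].
    by rewrite -map_comp.
  apply: tree_star => //.
    rewrite /= map_inj_uniq ?enum_uniq ?andbT; last by move=> x y /addnI/val_inj.
    by apply/mapP => -[m _ vm]; have := vN; rewrite vm ltnNge leq_addr.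
  by move=> j /mapP[m _ ->]; apply/negP => /sN; rewrite ltnNge leq_addr.
have [h run_st ht] := run_cat A s t.
have hE x : x \in h -> exists m, x.1 = E m.
  move=> xh; have : x.1 \in t by rewrite -ht; apply: map_f.
  by case/mapP => m _ ->; exists m.
have [m0 m0P] : exists m0 : 'I_k.+1, 0 < num_colored h -> 0 < colored_at (N + m0) h.
  case: (boolP (has (fun x => isSome x.2) h)) => [/hasP[x xh x2]|nh]; last first.
    by exists ord0; rewrite -has_count (negbTE nh).
  have [m xm] := hE x xh.
  exists m => _; rewrite /colored_at -has_count.
  apply/(@hasP (edge * option 'I_k)%type); exists x => //.
  by rewrite xm !inE eqxx orbT x2.
(* [unlift m0] gives distinct colors to the [k] leaves other than [m0] and [None] to the spine
   edge. *)
pose g' : history k := [seq (E m, unlift m0 m) | m <- enum 'I_k.+1].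
have g'E x : x \in g' -> exists m, x = (E m, unlift m0 m).
  by case/mapP => m _ ->; exists m.
have gN x u : x \in g -> u \in x.1 -> u < N.
  move=> xg ux; apply: sN; apply/hasP; exists x.1 => //.
  by rewrite -gs; apply: map_f.
exists (s ++ t), (N + m0), (N + k.+1), (g ++ g'); split=> //.
- right; rewrite /is_vertex has_cat; apply/orP; right; apply/hasP.
  by exists (E m0); rewrite ?map_f ?mem_enum // !inE eqxx orbT.
- split; first by rewrite ltn_add2l.
  move=> u; rewrite /is_vertex has_cat.
  case/orP=> [/sN|/hasP[_ /mapP[m _ ->]]]; first by lia.
  rewrite !inE => /predU1P[->|/eqP->]; first by lia.
  by rewrite ltn_add2l.
- have := colored_at_le v (hA _ tst); rewrite /ALG run_st.
  have -> : colored_at v (run A s ++ h) = colored_at v (run A s) + num_colored h.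
    rewrite /colored_at /num_colored count_cat; congr (_ + _).
    apply: (@eq_in_count (edge * option 'I_k)%type) => x /hE[m ->].
    by rewrite !inE eqxx.
  rewrite /num_colored count_cat -/(num_colored h) -/(num_colored _) -/(ALG A s).
  have : colored_at (N + m0) h <= colored_at (N + m0) (run A s ++ h).
    by rewrite /colored_at count_cat leq_addl.
  (* If no leaf edge is colored, the old surplus of at most 1 fits into [k.-1]. Otherwise the new
     surplus is 1, and an old surplus means that at most [k - 1] new edges are colored at [v]. *)
  move: m0P algs; have -> : k.-1 * i.+1 = k.-1 * i + k.-1 by rewrite mulnS addnC.
  by case: (num_colored h) => [|n] => [_|/(_ isT)];
    case: (colored_at v _) => [|a] /=; lia.
split.
- by rewrite /unzip1 map_cat -/(unzip1 g) gs -map_comp.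
- rewrite /proper_coloring pairwise_cat -/(proper_coloring g) pg /=; apply/andP; split.
    apply/allrelP => x y xg /g'E[m ->]; rewrite /compatible /=.
    case x2: x.2 => [c|]; last by rewrite orbT.
    (* By [gv] a colored edge of [g] avoids [v], and by [gN] it avoids the new leaves. *)
    apply/orP; left; apply/fdisjointP => u ux; rewrite !inE negb_or.
    apply/andP; split.
      by apply: contraTneq ux => ->; apply/negP => /(gv _ xg); rewrite x2.
    by have := gN _ _ xg ux; lia.
  rewrite pairwise_map; apply: sub_pairwise (_ : pairwise [rel x y | x != y] _).
    move=> x y /= xy; rewrite /compatible /=.
    case: unliftP => [c xc|]; last by rewrite eqxx orbT.
    case: unliftP => [d yd|]; last by rewrite !orbT.
    by apply/or3P; apply: Or33; apply: contraNneq xy => -[cd]; rewrite xc yd cd.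
  by rewrite -uniq_pairwise enum_uniq.
- move=> x; rewrite mem_cat => /orP[xg /(gN _ _ xg)|/g'E[m ->]]; first by lia.
  rewrite !inE /= => /predU1P[|/eqP/addnI/val_inj ->]; first by lia.
  by rewrite /= unlift_none.
- rewrite /num_colored count_cat mulnS addnC leq_add //.
  rewrite count_map -(eq_count (a1 := predC (pred1 m0))).
    have := count_predC (pred1 m0) (enum 'I_k.+1).
    by rewrite count_uniq_mem ?enum_uniq // mem_enum size_enum_ord add1n => -[->].
  move=> m /=; case: unliftP => [c ->|->]; last by rewrite eqxx.
  by rewrite eq_sym neq_lift.
Qed.

End Adversary.

(** * Competitive ratios *)

Import Order.TTheory GRing.Theory Num.Theory.
Local Open Scope ring_scope.

(** If [C * k] exceeded [k - 1] by [d > 0], the caterpillars would give [d * i <= 1 + b] for every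
    [i], against the Archimedean property. *)
Lemma competitive_le (R : realType) (k : nat) (A : algorithm k) (C : R) :
  (2 <= k)%N -> tree_algorithm A -> tree_competitive A C -> C <= (k%:R - 1) / k%:R.
Proof.
move=> k2 hA [b hb].
have k0 : 0 < k%:R :> R by rewrite ltr0n; lia.
rewrite ler_pdivlMr // leNgt; apply/negP => Ck.
pose d := C * k%:R - (k%:R - 1).
have d0 : 0 < d by rewrite subr_gt0.
have k1 : k.-1%:R = k%:R - 1 :> R by rewrite -subn1 natrB //; lia.
have C0 : 0 <= C.
  rewrite -(pmulr_lge0 _ k0); apply/ltW/(le_lt_trans _ Ck).
  by rewrite -k1 ler0n.
have bound (i : nat) : d * i%:R <= 1 + b.
  have [s [v [N [g [ts _ _ algs [gs pg _ gi]]]]]] := caterpillar k2 i hA.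
  have /(leq_trans gi) := OPT_ge pg; rewrite gs => opts.
  have : (ALG A s <= k.-1 * i + 1)%N by move: algs; case: (0 < _)%N => /=; lia.
  rewrite -(ler_nat R) natrD natrM k1 => algs'.
  have : C * (k%:R * i%:R) <= C * (OPT k s)%:R.
    by rewrite ler_wpM2l // -natrM ler_nat.
  by have := hb s ts; rewrite /d; lra.
have := archi_boundP (normr_ge0 ((1 + b) / d)).
set i := Num.bound _ => iP.
have : (1 + b) / d < i%:R := le_lt_trans (ler_norm _) iP.
by rewrite ltr_pdivrMr // mulrC ltNge bound.
Qed.

Lemma first_fit_competitive (R : realType) (k : nat) :
  (2 <= k)%N -> tree_competitive (first_fit k) ((k%:R - 1) / k%:R : R).
Proof.
move=> k2; exists 0 => s ts; rewrite subr0.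
have k0 : 0 < k%:R :> R by rewrite ltr0n; lia.
rewrite mulrAC ler_pdivrMr // [leRHS]mulrC.
have k1 : k.-1%:R = k%:R - 1 :> R by rewrite -subn1 natrB //; lia.
by rewrite -k1 -!natrM ler_nat; exact: first_fit_tree.
Qed.

Local Close Scope ring_scope.

Theorem theorem4 (R : realType) (k : nat) (hk : 2 <= k) :
  [/\ tree_algorithm (first_fit k),
      tree_competitive_ratio R (first_fit k) = ((k%:R - 1) / k%:R)%R%:E
    & forall A : algorithm k, tree_algorithm A ->
        (tree_competitive_ratio R A <= tree_competitive_ratio R (first_fit k))%E].
Proof.
have ff : tree_algorithm (first_fit k) by move=> s _; exact: proper_run_first_fit.
have ub (A : algorithm k) : tree_algorithm A ->
    (tree_competitive_ratio R A <= ((k%:R - 1) / k%:R)%R%:E)%E.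
  move=> hA; apply: ge_ereal_sup => _ [C hC <-]; rewrite lee_fin.
  exact: competitive_le hC.
have ratio : tree_competitive_ratio R (first_fit k) = ((k%:R - 1) / k%:R)%R%:E.
  apply/eqP; rewrite eq_le ub //=; apply: ereal_sup_ubound.
  by exists ((k%:R - 1) / k%:R)%R => //; exact: first_fit_competitive.
by split=> // A hA; rewrite ratio; exact: ub.
Qed.
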